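(* Assume that the obstacle $\Psi$ is differentiable and that $u_\infty(x)=K_\infty(x)$ for all $x\in\overline\Omega$. Then $u_\infty$ is differentiable at every point of the free boundary $\partial\{u_\infty=\Psi\}$ and $$Du_\infty(x_0)=D\Psi(x_0)\qquad\text{for all }x_0\in\partial\{u_\infty=\Psi\}.$$
   Context: Setting: $\Omega\subset\mathbb{R}^d$ is a bounded smooth domain, $F$ is a Lipschitz function on $\partial\Omega$, and $\Psi:\overline\Omega\to\mathbb{R}$ is a continuous obstacle with $\sup_{\partial\Omega}\Psi<\inf_{\partial\Omega}F$. For $1<p<\infty$, $u_p$ denotes the unique minimizer of $\int_\Omega|Dv|^p\,dx$ among all $v\in W^{1,p}(\Omega)$ with trace $F$ on $\partial\Omega$ and $v\ge\Psi$ in $\Omega$. The function $u_\infty$ denotes the limit of $u_p$ (along a subsequence) as $p\to\infty$, the convergence being locally uniform in $\overline\Omega$ and weak in $W^{1,q}(\Omega)$ for every finite $q>1$ (such a limit exists and does not depend on the subsequence). For $y\in\partial\Omega$ and $b=(b_1,b_2)\in\mathbb{R}^2$ with $b_1\ge0$, let $K_y^b(x)=b_1|x-y|+b_2$. Let $\mathcal{K}$ be the family of all such cones $K_y^b$ (over all $y\in\partial\Omega$ and all such $b$) which satisfy $K_y^b(x)\ge F(x)$ for all $x\in\partial\Omega$ and $K_y^b(x)\ge\Psi(x)$ for all $x\in\Omega$. Define $K_\infty(x)=\inf_{K_y^b\in\mathcal{K}}K_y^b(x)$ for $x\in\overline\Omega$. *)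

(* Defs.v *)
From HB Require Import structures.
From mathcomp Require Import all_boot all_order all_algebra.
From mathcomp Require Import all_classical all_reals all_analysis.
Import Order.TTheory GRing.Theory Num.Theory.
Import numFieldNormedType.Exports.

Set Implicit Arguments.
Unset Strict Implicit.
Unset Printing Implicit Defensive.

Local Open Scope classical_set_scope.
Local Open Scope ring_scope.

(* The library norm on ['rV[R]_d] is the sup norm: it is used only through the
   topology and differential calculus, which do not depend on the norm. *)
Definition enorm (R : realType) (d : nat) (x : 'rV[R]_d) : R :=
  Num.sqrt (\sum_(i < d) x 0 i ^+ 2).

Definition frontier (T : topologicalType) (A : set T) : set T :=
  closure A `\` interior A.

Section covering_outer_measure.
Context (R : realType) (T : pointedType).
Local Open Scope ereal_scope.
Variable cost : set T -> \bar R.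

Definition cover_cost (U : set T) : \bar R := if U == set0 then 0 else cost U.

(* inf of \sum_k cost (U_k) over all countable covers (U_k); every subset of T
   is measurable in the sigma-algebra used here, so covers are unrestricted. *)
Definition cover_outer (A : set T) : \bar R :=
  @mu_ext _ (g_sigma_algebraType [set: set T]) R cover_cost A.

Hypothesis cost_ge0 : forall U, U !=set0 -> 0 <= cost U.

Lemma cover_cost0 : cover_cost set0 = 0.
Proof. by rewrite /cover_cost eqxx. Qed.

Lemma cover_cost_ge0 U : 0 <= cover_cost U.
Proof.
by rewrite /cover_cost; case: ifPn => // /set0P U0; exact: cost_ge0.
Qed.

Lemma cover_outer0 : cover_outer set0 = 0.
Proof. exact: (@mu_ext0 _ (g_sigma_algebraType [set: set T]) R
  cover_cost cover_cost0 cover_cost_ge0). Qed.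

Lemma cover_outer_ge0 A : 0 <= cover_outer A.
Proof. exact: (@mu_ext_ge0 _ (g_sigma_algebraType [set: set T]) R
  cover_cost cover_cost_ge0). Qed.

Lemma le_cover_outer : {homo cover_outer : A B / A `<=` B >-> A <= B}.
Proof. by move=> A B; exact: (@le_mu_ext _ (g_sigma_algebraType [set: set T]) R). Qed.

Lemma cover_outer_sigma_subadditive : sigma_subadditive cover_outer.
Proof. exact: (@mu_ext_sigma_subadditive _ (g_sigma_algebraType [set: set T]) R
  cover_cost cover_cost_ge0). Qed.

End covering_outer_measure.

Definition caratheodory_measure (R : realType) (T : pointedType)
    (mu : {outer_measure set T -> \bar R}) :
    {measure set (caratheodory_type mu) -> \bar R} :=
  [the measure _ _ of (mu : set (caratheodory_type mu) -> \bar R)].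

Section lebesgue_Rn.
Context (R : realType) (d : nat).
Local Open Scope ereal_scope.

Definition closed_box (a b : 'rV[R]_d) : set 'rV[R]_d :=
  [set x | forall i, (a 0 i <= x 0 i <= b 0 i)%R].

(* [+oo] on sets that are not closed boxes *)
Definition box_volume (U : set 'rV[R]_d) : \bar R :=
  ereal_inf [set (\prod_(i < d) (ab.2 0 i - ab.1 0 i)%R)%:E
    | ab in [set ab | U = closed_box ab.1 ab.2]].

Definition lebesgue_outer : set 'rV[R]_d -> \bar R := cover_outer box_volume.

Lemma box_volume_ge0 U : U !=set0 -> 0 <= box_volume U.
Proof.
move=> [x Ux]; apply: le_ereal_inf_tmp => _ [[a b] /= Uab <-].
rewrite lee_fin; apply: prodr_ge0 => i _; rewrite subr_ge0.
by move: Ux; rewrite Uab => /(_ i) /andP[]; exact: le_trans.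
Qed.

HB.instance Definition _ := isOuterMeasure.Build R 'rV[R]_d lebesgue_outer
  (cover_outer0 box_volume_ge0) (cover_outer_ge0 box_volume_ge0)
  (@le_cover_outer _ _ box_volume)
  (cover_outer_sigma_subadditive box_volume_ge0).

Definition lebesgueRn := caratheodory_measure lebesgue_outer.

End lebesgue_Rn.

(* (d-1)-dimensional Hausdorff measure, without the normalising constant,
   which is irrelevant to convergence in L^p(dOmega). *)
Section hausdorff.
Context (R : realType) (d : nat).
Local Open Scope ereal_scope.

Definition diam (U : set 'rV[R]_d) : \bar R :=
  ereal_sup [set (enorm (xy.1 - xy.2)%R)%:E | xy in U `*` U].

Definition diam_cost (delta : R) (U : set 'rV[R]_d) : \bar R :=
  if diam U <= delta%:E then diam U ^+ d.-1 else +oo.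

Definition surface_outer (A : set 'rV[R]_d) : \bar R :=
  ereal_sup [set cover_outer (diam_cost delta) A
    | delta in [set delta : R | (0 < delta)%R]].

Lemma diam_cost_ge0 delta U : U !=set0 -> 0 <= diam_cost delta U.
Proof.
move=> [x Ux]; rewrite /diam_cost; case: ifP => // _; apply: expe_ge0.
apply: ereal_sup_ubound; exists (x, x) => //=.
rewrite subrr /enorm big1 ?sqrtr0// => i _.
by rewrite mxE expr0n.
Qed.

Lemma surface_outer0 : surface_outer set0 = 0.
Proof.
apply/eqP; rewrite eq_le; apply/andP; split.
  apply: ge_ereal_sup => _ [e _ <-].
  by rewrite (cover_outer0 (@diam_cost_ge0 e)).
apply: ereal_sup_ubound; exists 1%R => /=; first exact: ltr01.
exact: (cover_outer0 (@diam_cost_ge0 _)).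
Qed.

Lemma surface_outer_ge0 A : 0 <= surface_outer A.
Proof.
apply: (@le_trans _ _ (cover_outer (diam_cost 1) A)).
  exact: (cover_outer_ge0 (@diam_cost_ge0 _)).
by apply: ereal_sup_ubound; exists 1%R => //=; exact: ltr01.
Qed.

Lemma le_surface_outer : {homo surface_outer : A B / A `<=` B >-> A <= B}.
Proof.
move=> A B AB; apply: ge_ereal_sup => _ [e e0 <-].
apply: (le_trans (le_cover_outer _ AB)).
by apply: ereal_sup_ubound; exists e.
Qed.

Lemma surface_outer_sigma_subadditive : sigma_subadditive surface_outer.
Proof.
move=> A; apply: ge_ereal_sup => _ [e e0 <-].
apply: (le_trans (cover_outer_sigma_subadditive (@diam_cost_ge0 e) A)).
apply: lee_nneseries => n _ *.
  exact: (cover_outer_ge0 (@diam_cost_ge0 e)).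
by apply: ereal_sup_ubound; exists e.
Qed.

HB.instance Definition _ := isOuterMeasure.Build R 'rV[R]_d surface_outer
  surface_outer0 surface_outer_ge0 le_surface_outer
  surface_outer_sigma_subadditive.

Definition surface_measure := caratheodory_measure surface_outer.

End hausdorff.

Section smooth.
Context (R : realType).

Definition partial (d : nat) (i : 'I_d) (f : 'rV[R]_d -> R) : 'rV[R]_d -> R :=
  'D_(delta_mx 0 i) f.

Definition grad (d : nat) (f : 'rV[R]_d -> R) (x : 'rV[R]_d) : 'rV[R]_d :=
  \row_i partial i f x.

Fixpoint class_C (d k : nat) (f : 'rV[R]_d -> R) : Prop :=
  if k is k'.+1 then
    (forall x, differentiable f x) /\ forall i, class_C k' (partial i f)
  else continuous f.

Definition smooth (d : nat) (f : 'rV[R]_d -> R) : Prop :=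
  forall k, class_C k f.

(* Near each boundary point, and for a suitable coordinate direction [i] and
   orientation [s], Omega is the epigraph of a smooth function of the other
   d-1 coordinates. *)
Definition smooth_boundary (d : nat) (Omega : set 'rV[R]_d) : Prop :=
  forall x0, frontier Omega x0 ->
  exists r : R, exists i : 'I_d, exists s : bool, exists gamma : 'rV[R]_d.-1 -> R,
    [/\ 0 < r, smooth gamma &
      forall y, enorm (y - x0) < r ->
        (Omega y <-> gamma (col' i y) < (-1) ^+ s * y 0 i)].

Definition bounded_smooth_domain (d : nat) (Omega : set 'rV[R]_d) : Prop :=
  [/\ open Omega, connected Omega, Omega !=set0, bounded_set Omega
    & smooth_boundary Omega].

End smooth.

Section sobolev.
Context (R : realType) (d : nat).
Implicit Types (Omega : set 'rV[R]_d) (v w F : 'rV[R]_d -> R).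
Implicit Types (g h : 'rV[R]_d -> 'rV[R]_d) (p q : R).

Local Notation leb := (@lebesgueRn R d).
Local Notation sigma := (@surface_measure R d).

Definition pintegral Omega p v : \bar R :=
  (\int[leb]_(x in Omega) (`|v x| `^ p)%:E)%E.

Definition test_function Omega (phi : 'rV[R]_d -> R) : Prop :=
  [/\ smooth phi, compact (closure [set x | phi x != 0])
    & closure [set x | phi x != 0] `<=` Omega].

Definition weak_gradient Omega v g : Prop :=
  forall phi, test_function Omega phi -> forall i : 'I_d,
    \int[leb]_(x in Omega) (v x * partial i phi x) =
    - \int[leb]_(x in Omega) (g x 0 i * phi x).

(* v belongs to W^{1,p}(Omega), and g is its distributional gradient *)
Definition sobolev_grad Omega p v g : Prop :=
  [/\ measurable_fun (Omega : set (caratheodory_type (@lebesgue_outer R d))) v,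
      forall i : 'I_d,
        measurable_fun (Omega : set (caratheodory_type (@lebesgue_outer R d))) (fun x => g x 0 i),
      (pintegral Omega p v < +oo)%E,
      (pintegral Omega p (fun x => enorm (g x)) < +oo)%E
    & weak_gradient Omega v g].

Definition sobolev Omega p : set ('rV[R]_d -> R) :=
  [set v | exists g, sobolev_grad Omega p v g].

Definition sobolev_norm Omega p v g : \bar R :=
  ((pintegral Omega p v + pintegral Omega p (fun x => enorm (g x))) `^ p^-1)%E.

(* The trace operator W^{1,p}(Omega) -> L^p(dOmega) is the continuous extension
   of the restriction w |-> w|_dOmega of functions smooth up to the boundary. *)
Definition has_trace Omega p v g F : Prop :=
  exists w : nat -> 'rV[R]_d -> R,
    [/\ forall n, smooth (w n),
        sobolev_norm Omega p (fun x => w n x - v x)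
          (fun x => grad (w n) x - g x) @[n --> \oo] --> 0%E
      & (\int[sigma]_(x in frontier Omega) (`|w n x - F x| `^ p)%:E)%E
          @[n --> \oo] --> 0%E].

Definition bounded_functional Omega q (L : ('rV[R]_d -> R) -> R) : Prop :=
  (forall (a : R) v w, sobolev Omega q v -> sobolev Omega q w ->
     L (fun x => a * v x + w x) = a * L v + L w) /\
  exists C : R, forall v g, sobolev_grad Omega q v g ->
    (`|L v|%:E <= C%:E * sobolev_norm Omega q v g)%E.

(* Weak convergence in W^{1,q}(Omega); finitely many terms of the sequence may
   lie outside W^{1,q}(Omega). *)
Definition weakly_converges Omega q (v_ : nat -> 'rV[R]_d -> R) v : Prop :=
  [/\ \forall k \near \oo, sobolev Omega q (v_ k),
      sobolev Omega q v
    & forall L, bounded_functional Omega q L ->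
        L (v_ k) @[k --> \oo] --> L v].

End sobolev.

Section obstacle.
Context (R : realType) (d : nat).
Implicit Types (Omega : set 'rV[R]_d) (F Psi u v : 'rV[R]_d -> R) (p : R).

Definition admissible Omega F Psi p v (g : 'rV[R]_d -> 'rV[R]_d) : Prop :=
  [/\ sobolev_grad Omega p v g, has_trace Omega p v g F
    & {ae @lebesgueRn R d, forall x, Omega x -> Psi x <= v x}].

Definition is_obstacle_minimizer Omega F Psi p u : Prop :=
  exists2 g, admissible Omega F Psi p u g &
    forall v h, admissible Omega F Psi p v h ->
      (pintegral Omega p (fun x => enorm (g x)) <=
       pintegral Omega p (fun x => enorm (h x)))%E.

Definition locally_uniform_cvg (A : set 'rV[R]_d)
    (v_ : nat -> 'rV[R]_d -> R) v : Prop :=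
  forall x, A x -> exists2 U, nbhs x U & {uniform U `&` A, v_ @ \oo --> v}.

(* Sobolev functions are represented by pointwise defined functions; for the
   uniform convergence the (eventually existing, as p > d) continuous
   representatives of the minimizers are used. *)
Definition is_limit_of_minimizers Omega F Psi u : Prop :=
  exists (p_ : nat -> R) (u_ : nat -> 'rV[R]_d -> R),
    [/\ p_ k @[k --> \oo] --> +oo,
        forall k, 1 < p_ k /\ is_obstacle_minimizer Omega F Psi (p_ k) (u_ k),
        \forall k \near \oo, {within closure Omega, continuous (u_ k)},
        locally_uniform_cvg (closure Omega) u_ u
      & forall q, 1 < q -> weakly_converges Omega q u_ u].

Definition cone (y : 'rV[R]_d) (b : R * R) (x : 'rV[R]_d) : R :=
  b.1 * enorm (x - y) + b.2.

Definition admissible_cone Omega F Psi (y : 'rV[R]_d) (b : R * R) : Prop :=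
  [/\ frontier Omega y, 0 <= b.1,
      forall x, frontier Omega x -> F x <= cone y b x
    & forall x, Omega x -> Psi x <= cone y b x].

Definition K_infty Omega F Psi (x : 'rV[R]_d) : R :=
  inf [set cone yb.1 yb.2 x
    | yb in [set yb | admissible_cone Omega F Psi yb.1 yb.2]].

Definition contact_set Omega Psi u : set 'rV[R]_d :=
  [set x | closure Omega x /\ u x = Psi x].

End obstacle.

(* Main.v *)
(* The infimum defining K_infty x0 at an interior point x0 is attained, by
   compactness, by a cone K whose vertex lies on the boundary, so that K is
   differentiable at x0. At a contact point u_infty is squeezed between Psi and K,
   which agree there, so all three have the same differential. Contact points
   never lie on the boundary, where u_infty >= F > Psi, and the contact set is
   closed since u_infty is a locally uniform limit of continuous functions. *)
Require Import Defs.
From mathcomp Require Import all_boot all_order all_algebra.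
From mathcomp Require Import all_classical all_reals all_analysis.
From mathcomp Require Import ring lra.
Import Order.TTheory GRing.Theory Num.Theory.
Import numFieldNormedType.Exports.

Local Open Scope classical_set_scope.
Local Open Scope ring_scope.

(** * Differentiability of a function squeezed between two differentiable ones *)

Section squeeze.
Context {R : realType} {V : normedModType R}.
Implicit Types (f g h u : V -> R) (x : V).

(** Minimality in the first-order expansion gives [- 'd h x w <= e * |w|] near 0; the same bound at
    [- w] controls the other sign. So the differential is a linear map that is o(w), hence zero. *)
Lemma diff_local_min h x : differentiable h x ->
  (\forall y \near x, h x <= h y) -> 'd h x = cst 0 :> (V -> R).
Proof.
move=> dh hmin; apply: littleo_linear0; apply/eqoP => e e0.
have /eqaddoP/(_ e e0) := diff_locally dh.
rewrite (near_shift 0 x) subr0 in hmin.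
move=> /= oe.
have dle : \forall w \near (0 : V), - 'd h x w <= e * `|w|.
  near=> w.
  have : h x <= h (w + x) by near: w; exact: hmin.
  have : `|h (w + x) - (h x + 'd h x w)| <= e * `|w| by near: w; exact: oe.
  by move=> /ler_normlP[]; lra.
have dle' : \forall w \near (0 : V), 'd h x w <= e * `|w|.
  have : - w @[w --> (0 : V)] --> (0 : V).
    by rewrite -[X in _ --> X]oppr0; apply: cvgN; exact: cvg_id.
  move=> /(_ _ dle); rewrite near_simpl /= => ge.
  near=> w; rewrite -[w]opprK linearN normrN.
  near: w; exact: ge.
near=> w; rewrite ler_norml; apply/andP; split.
  by rewrite lerNl; near: w; exact: dle.
by near: w; exact: dle'.
Unshelve. all: by end_near. Qed.

(** The difference [g - f] is nonnegative near [x] and vanishes at [x], so [f] and [g] have the same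
    differential there. Their expansions then share the linear part, and [u], trapped between them,
    inherits it with the same error bound. *)
Lemma differentiable_squeeze f u g x :
  differentiable f x -> differentiable g x -> f x = u x -> g x = u x ->
  (\forall y \near x, f y <= u y <= g y) ->
  differentiable u x /\ 'd u x = 'd f x :> (V -> R).
Proof.
move=> df dg fux gux fug.
have dfg : 'd g x = 'd f x :> (V -> R).
  apply/subr0_eq; rewrite -[LHS]/(_ \- _) -diffB//.
  apply: diff_local_min; first exact: differentiableB.
  apply: filterS fug => y /andP[fu ug].
  by rewrite -[leLHS]/(g x - f x) -[leRHS]/(g y - f y) gux fux subrr subr_ge0 (le_trans fu).
(* [dfg] equates the underlying functions, not the bundled linear maps, so ['d f x] is put into the
   expansion of [g] through an explicit predicate. *)
have gdf := eq_ind _ (fun L : V -> R => g \o shift x = cst (g x) + L +o_ 0 id)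
  (diff_locally dg) _ dfg.
have ou : u \o shift x = cst (u x) + 'd f x +o_ 0 id.
  apply/eqaddoP => e e0.
  have /eqaddoP/(_ e e0) of_ := diff_locally df.
  move: gdf => /eqaddoP/(_ e e0) og.
  rewrite (near_shift 0 x) subr0 in fug.
  near=> w.
  have : `|f (w + x) - (f x + 'd f x w)| <= e * `|w| by near: w; exact: of_.
  have : `|g (w + x) - (g x + 'd f x w)| <= e * `|w| by near: w; exact: og.
  have /andP[] : f (w + x) <= u (w + x) <= g (w + x) by near: w; exact: fug.
  rewrite fux gux => h1 h2 /ler_normlP[h3 h4] /ler_normlP[h5 h6].
  rewrite -[X in `|X|]/(u (w + x) - (u x + 'd f x w)).
  by apply/ler_normlP; split; lra.
(* A continuous linear map with such an expansion is unique, so [ou] identifies the differential of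
   [u]. *)
have duf : 'd u x = 'd f x :> (V -> R).
  by apply: diff_unique ou; exact: diff_continuous.
split => //; apply/diff_locallyP; rewrite duf; split => //.
exact: diff_continuous.
Unshelve. all: by end_near. Qed.

End squeeze.

(** * Regularity of the Euclidean norm and of cones *)

Section euclidean_norm.
Context {R : realType} {d : nat}.
Implicit Types x y : 'rV[R]_d.

Lemma enorm0 : enorm (0 : 'rV[R]_d) = 0.
Proof.
by rewrite /enorm big1 ?sqrtr0// => i _; rewrite mxE expr0n.
Qed.

Lemma sum_sqr_gt0 {x} : x != 0 -> 0 < \sum_(i < d) x 0 i ^+ 2.
Proof.
move=> x0; rewrite lt_neqAle sumr_ge0 ?andbT => [|i _]; last exact: sqr_ge0.
apply: contra x0 => /eqP/esym/psumr_eq0P s0; apply/eqP/rowP => i.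
apply/eqP; rewrite mxE -sqrf_eq0; apply/eqP; apply: s0 => //.
by move=> j _; exact: sqr_ge0.
Qed.

Lemma enorm_gt0 x : x != 0 -> 0 < enorm x.
Proof. by move=> x0; rewrite sqrtr_gt0 sum_sqr_gt0. Qed.

Lemma differentiable_sum_sqr x :
  differentiable (fun y : 'rV[R]_d => \sum_(i < d) y 0 i ^+ 2) x.
Proof.
have -> : (fun y : 'rV[R]_d => \sum_(i < d) y 0 i ^+ 2) =
    \sum_(i < d) (fun y : 'rV[R]_d => y 0 i) ^+ 2.
  by apply/funext => y; rewrite fct_sumE.
apply: differentiable_sum => i; apply: differentiableX.
exact: differentiable_coord.
Qed.

Lemma enorm_continuous : continuous (@enorm R d).
Proof.
move=> x.
apply: (@continuous_comp _ _ _ (fun y : 'rV[R]_d => \sum_(i < d) y 0 i ^+ 2)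
  Num.sqrt); last exact: sqrt_continuous.
exact/differentiable_continuous/differentiable_sum_sqr.
Qed.

(** The sum of squares is positive away from the origin, where the square root is differentiable. *)
Lemma differentiable_enorm x : x != 0 -> differentiable (@enorm R d) x.
Proof.
move=> x0; apply: (@differentiable_comp _ _ _ _ _ Num.sqrt).
  exact: differentiable_sum_sqr.
apply/derivable1_diffP.
by have [] := is_derive1_sqrt (sum_sqr_gt0 x0).
Qed.

Lemma differentiable_cone (y : 'rV[R]_d) b x :
  x != y -> differentiable (cone y b) x.
Proof.
move=> xy; rewrite [cone y b](_ : _ =
  b.1 *: (@enorm R d \o (fun z => z - y)) + cst b.2)//.
apply: differentiableD => //; apply: differentiableZ.
apply: differentiable_comp; first exact: differentiableB.
by apply: differentiable_enorm; rewrite subr_eq0.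
Qed.

(** Joint continuity in apex, slope and offset is what the compactness argument over the family of
    cones needs. *)
Lemma cone_param_continuous x :
  continuous (fun yb : 'rV[R]_d * (R * R) => cone yb.1 yb.2 x).
Proof.
move=> yb; apply: cvgD; last first.
  by apply: (@continuous_comp _ _ _ snd snd); exact: cvg_snd.
apply: cvgM.
  by apply: (@continuous_comp _ _ _ snd fst); [exact: cvg_snd|exact: cvg_fst].
apply: (@continuous_comp _ _ _ (fun z : 'rV[R]_d * (R * R) => x - z.1)
    (@enorm R d)).
  by apply: cvgB; [exact: cvg_cst|exact: cvg_fst].
exact: enorm_continuous.
Qed.

End euclidean_norm.

Lemma lipschitz_bounded {R : realType} {V W : normedModType R} {f : V -> W}
    {A : set V} : bounded_set A -> [lipschitz f x | x in A] ->
  exists M, forall x, A x -> `|f x| <= M.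
Proof.
move=> /pinfty_ex_gt0[r _ Ar] /pinfty_ex_gt0[k k0 fk].
have [->|/set0P[a Aa]] := eqVneq A set0; first by exists 0.
(* Any two points of [A] are at distance at most [r + r], and [k] is a Lipschitz constant. *)
exists (`|f a| + k * (r + r)) => x Ax.
rewrite -[f x](subrK (f a)) (le_trans (ler_normD _ _))// addrC lerD2l.
apply: (le_trans (fk (x, a) (conj Ax Aa))) => /=.
by rewrite ler_pM2l// (le_trans (ler_normB _ _))// lerD// Ar.
Qed.

(** * Compactness of the cone parameters and attainment of the infimum *)

Section domain.
Context {R : realType} {d : nat} {Omega : set 'rV[R]_d}.
Hypothesis Omega_bounded : bounded_set Omega.

Lemma closure_bounded : bounded_set (closure Omega).
Proof.
apply: (@filterS _ (pinfty_nbhs R) _ _ _ _ Omega_bounded) => r Or.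
have cB : closed [set x : 'rV[R]_d | `|x| <= r].
  apply: (preimage_closed _ (@closed_le _ r)) => x _; exact: norm_continuous.
move=> x /(closure_subset Or).
by have := cB; rewrite closure_id => <-.
Qed.

Lemma compact_closure_bounded : compact (closure Omega).
Proof.
apply: bounded_closed_compact; first exact: closure_bounded.
exact: closed_closure.
Qed.

Lemma compact_frontier : compact (frontier Omega).
Proof.
rewrite /frontier setDE; apply: compact_closedI.
  exact: compact_closure_bounded.
by apply: open_closedC; exact: open_interior.
Qed.

Variables F Psi : 'rV[R]_d -> R.

Local Notation cones :=
  [set yb : 'rV[R]_d * (R * R) | admissible_cone Omega F Psi yb.1 yb.2].

Lemma cone_apex (y : 'rV[R]_d) (b : R * R) : cone y b y = b.2.
Proof. by rewrite /cone subrr enorm0 mulr0 add0r. Qed.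

(** Each condition is a weak inequality between continuous functions of the parameters or membership
    of the apex in the closed boundary; any intersection of such conditions is closed. *)
Lemma closed_admissible_cones : closed cones.
Proof.
have clF : closed (frontier Omega).
  rewrite /frontier setDE; apply: closedI; first exact: closed_closure.
  by apply: open_closedC; exact: open_interior.
have -> : cones = [set yb | frontier Omega yb.1] `&` [set yb | 0 <= yb.2.1] `&`
    (\bigcap_(x in frontier Omega) [set yb | F x <= cone yb.1 yb.2 x]) `&`
    (\bigcap_(x in Omega) [set yb | Psi x <= cone yb.1 yb.2 x]).
  by apply/seteqP; split => [yb []//|yb [[[]]]]; split.
have clcone a x : closed [set yb : 'rV[R]_d * (R * R) | a <= cone yb.1 yb.2 x].
  apply: (preimage_closed (f := fun yb => cone yb.1 yb.2 x) _ (@closed_ge _ a)).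
  by move=> yb _; exact: cone_param_continuous.
apply: closedI; [apply: closedI; [apply: closedI|]|].
- by apply: (preimage_closed (f := fst) _ clF) => yb _; exact: cvg_fst.
- apply: (preimage_closed (f := fun yb => yb.2.1) _ (@closed_ge _ 0)) => yb _.
  by apply: (@continuous_comp _ _ _ snd fst); [exact: cvg_snd|exact: cvg_fst].
- by apply: closed_bigI => x _; exact: clcone.
- by apply: closed_bigI => x _; exact: clcone.
Qed.

(* Among the admissible cones whose value at [x] is at most that of a fixed one,
   the offset [b.2 = cone y b y] is at least [m] and the slope [b.1] is bounded
   because [x] is at positive distance from the boundary: these parameters form
   a compact set. *)
Lemma K_infty_attained {m : R} {x} : Omega° x ->
  (forall y, frontier Omega y -> m <= F y) -> cones !=set0 ->
  exists yb, admissible_cone Omega F Psi yb.1 yb.2 /\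
    cone yb.1 yb.2 x = K_infty Omega F Psi x.
Proof.
move=> Ox mF [yb0 adm0].
have [y1 Fy1 y1min] : exists2 y1, y1 \in frontier Omega &
    forall y, y \in frontier Omega -> enorm (x - y1) <= enorm (x - y).
  apply: compact_EVT_min; [by case: adm0; exists yb0.1|exact: compact_frontier|].
  apply: continuous_subspaceT => y.
  apply: (@continuous_comp _ _ _ (fun z : 'rV[R]_d => x - z) (@enorm R d)).
    by apply: (@continuousB _ _ _ (cst x) id) => //; exact: cst_continuous.
  exact: enorm_continuous.
set delta := enorm (x - y1).
have delta_gt0 : 0 < delta.
  apply: enorm_gt0; rewrite subr_eq0; apply/eqP => xy.
  by move: Fy1; rewrite -xy inE => -[].
set C := cone yb0.1 yb0.2 x.
pose S := cones `&` [set yb | cone yb.1 yb.2 x <= C].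
have cptS : compact S.
  (* As [delta] is the distance from [x] to the boundary, [delta * b.1 + b.2 <= C]. The bound
     [m <= b.2] leaves at most [(C - m) / delta] for the slope, and [0 <= delta * b.1] gives
     [b.2 <= C]. *)
  apply: (@subclosed_compact _ _
    (frontier Omega `*` (`[0, (C - m) / delta] `*` `[m, C]))).
  - apply: closedI; first exact: closed_admissible_cones.
    apply: (preimage_closed (f := fun yb => cone yb.1 yb.2 x) _ (@closed_le _ C)).
    by move=> yb _; exact: cone_param_continuous.
  - apply: compact_setX; first exact: compact_frontier.
    by apply: compact_setX; exact: segment_compact.
  move=> [y b] [[/= Fy b0 FK _] bC].
  have mb : m <= b.2 by rewrite -(cone_apex y) (le_trans (mF _ Fy))// FK.
  have db : delta * b.1 <= b.1 * enorm (x - y).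
    by rewrite mulrC ler_wpM2l// y1min// inE.
  have db0 : 0 <= delta * b.1 by rewrite mulr_ge0// ltW.
  rewrite /cone in bC.
  split => //=; rewrite !in_itv/= b0 mb/=; split; last by lra.
  by rewrite ler_pdivlMr// mulrC; lra.
have [yb /set_mem[adm ybC] ybmin] : exists2 yb, yb \in S &
    forall yb', yb' \in S -> cone yb.1 yb.2 x <= cone yb'.1 yb'.2 x.
  apply: compact_EVT_min => //; first by exists yb0; split => //=.
  by apply: continuous_subspaceT; exact: cone_param_continuous.
(* Admissible cones outside [S] exceed [C] at [x], so the minimum over [S] is global. *)
have lb yb' : cones yb' -> cone yb.1 yb.2 x <= cone yb'.1 yb'.2 x.
  move=> adm'; have [le|/ltW lt] := leP (cone yb'.1 yb'.2 x) C.
    by apply: ybmin; rewrite inE.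
  exact: le_trans ybC lt.
exists yb; split => //; apply/eqP; rewrite eq_le; apply/andP; split.
  apply: lb_le_inf; first by exists (cone yb.1 yb.2 x), yb.
  by move=> _ [yb' adm' <-]; exact: lb.
apply: ge_inf; last by exists yb.
by exists (cone yb.1 yb.2 x) => _ [yb' adm' <-]; exact: lb.
Qed.

End domain.

(** * Continuity of the limit and closedness of the contact set *)

Lemma locally_uniform_cvg_continuous {R : realType} {d : nat} {A : set 'rV[R]_d}
    {u_ : nat -> 'rV[R]_d -> R} {u : 'rV[R]_d -> R} :
  (\forall k \near \oo, {within A, continuous (u_ k)}) ->
  locally_uniform_cvg A u_ u -> {within A, continuous u}.
Proof.
move=> u_c uu; apply/subspace_continuousP => x Ax.
have [U Ux u_u] := uu x Ax.
have : {within U `&` A, continuous u}.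
  apply: (@uniform_limit_continuous_subspace _ _ _ (u_ @ \oo)) u_u.
  near=> k; apply: (@continuous_subspaceW _ _ _ A); first by move=> ? [].
  by near: k.
(* Since [U] is a neighbourhood of [x], continuity at [x] within [U] and [A] together is continuity
   within [A]. *)
move=> /subspace_continuousP/(_ x (conj (nbhs_singleton Ux) Ax)).
apply: cvg_trans => B; rewrite /= !nbhs_simpl /= => BU.
apply: filterS (filterI Ux BU) => y [Uy] /= + Ay; exact.
Unshelve. all: by end_near. Qed.

(** If [u - Psi] were nonzero at a limit of contact points, it would stay nonzero nearby in the
    closure of [Omega], where contact points exist. *)
Lemma contact_set_closed {R : realType} {d : nat} {Omega : set 'rV[R]_d}
    {Psi u : 'rV[R]_d -> R} :
  {within closure Omega, continuous Psi} ->
  {within closure Omega, continuous u} ->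
  closed (contact_set Omega Psi u).
Proof.
move=> cPsi cu x clx.
have Ox : closure Omega x.
  have := @closed_closure _ Omega; rewrite closure_id => ->.
  by apply: closure_subset clx => z [].
split => //; apply/eqP; rewrite -subr_eq0; apply/negP => /negP ne0.
have : {within closure Omega, continuous (u - Psi)}.
  by move=> z; apply: cvgB; [exact: cu|exact: cPsi].
move=> /subspace_continuousP/(_ x Ox).
move=> /cvgr_neq0/(_ ne0); rewrite near_withinE.
move=> /clx[z [[Oz uz]]] /(_ Oz)/eqP; apply; apply/eqP.
by rewrite -[eqbLHS]/(u z - Psi z) uz subrr.
Qed.

Theorem corollary2p6 (R : realType) (d : nat) (d_gt0 : (0 < d)%N)
    (Omega : set 'rV[R]_d) (F Psi u_infty : 'rV[R]_d -> R)
    (Omega_dom : bounded_smooth_domain Omega)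
    (F_lip : [lipschitz F x | x in frontier Omega])
    (Psi_cont : {within closure Omega, continuous Psi})
    (Psi_lt_F : sup (Psi @` frontier Omega) < inf (F @` frontier Omega))
    (u_infty_lim : is_limit_of_minimizers Omega F Psi u_infty)
    (Psi_diff : forall x, Omega x -> differentiable Psi x)
    (u_infty_K : forall x, closure Omega x -> u_infty x = K_infty Omega F Psi x) :
  forall x0, frontier (contact_set Omega Psi u_infty) x0 ->
    differentiable u_infty x0 /\ 'd u_infty x0 = 'd Psi x0 :> ('rV[R]_d -> R).
Proof.
move=> x0 [clx0 _].
have [oO _ _ bO _] := Omega_dom.
have u_cont : {within closure Omega, continuous u_infty}.
  have [p_ [u_ [_ _ u_c uu _]]] := u_infty_lim.
  exact: locally_uniform_cvg_continuous u_c uu.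
have [Ox0 ux0] := contact_set_closed Psi_cont u_cont _ clx0.
have cptO := compact_closure_bounded bO.
have [M FM] : exists M, forall x, frontier Omega x -> `|F x| <= M.
  apply: lipschitz_bounded F_lip.
  exact/compact_bounded/compact_frontier.
have [N PsiN] : exists N, forall x, closure Omega x -> `|Psi x| <= N.
  have /compact_bounded/pinfty_ex_gt0[N _ PN] := continuous_compact Psi_cont cptO.
  by exists N => x Ox; apply: PN; exists x.
(* On an empty boundary both [sup] and [inf] take the default value 0, and [Psi_lt_F] would read
   [0 < 0]. *)
have [y0 Fy0] : frontier Omega !=set0.
  apply/set0P/eqP => F0.
  by move: Psi_lt_F; rewrite F0 !image_set0 sup0 inf0 ltxx.
have cones0 : [set yb | admissible_cone Omega F Psi yb.1 yb.2] !=set0.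
  (* A cone of slope 0 is constant; this height dominates both [F] and [Psi]. *)
  exists (y0, (0, Num.max M N)); split => //= x Ox; rewrite /cone mul0r add0r.
    by rewrite le_max (le_trans (ler_norm _) (FM _ Ox)).
  rewrite le_max (le_trans (ler_norm _) (PsiN _ _)) ?orbT//.
  exact: subset_closure.
have Ox0' : Omega x0.
  apply: contrapT => nOx0.
  have Fx0 : frontier Omega x0 by split => // /interior_subset.
  (* The real [sup] and [inf] control pointwise values only on bounded sets; [N] and [- M] supply
     the bounds. *)
  have PsiF : Psi x0 < F x0.
    apply: (le_lt_trans _ (lt_le_trans Psi_lt_F _)).
      apply: ub_le_sup; last by exists x0.
      exists N => _ [x [Ox _] <-]; exact: le_trans (ler_norm _) (PsiN _ Ox).
    apply: ge_inf; last by exists x0.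
    by exists (- M) => _ [x Fx <-]; have /ler_normlP[? ?] := FM _ Fx; lra.
  have : F x0 <= Psi x0.
    rewrite -ux0 u_infty_K//; apply: lb_le_inf.
      by have [yb adm] := cones0; exists (cone yb.1 yb.2 x0), yb.
    by move=> _ [yb [_ _ FK _] <-]; exact: FK.
  by rewrite leNgt PsiF.
have FM' y : frontier Omega y -> - M <= F y.
  by move=> Fy; have /ler_normlP[? ?] := FM _ Fy; lra.
have iOx0 : Omega° x0 by rewrite (interior_id _).1.
have [[y b] /= [adm Kx0]] := K_infty_attained bO _ _ iOx0 FM' cones0.
have [Fy _ _ PsiK] := adm.
have x0y : x0 != y.
  by apply/eqP => xy; case: Fy => _; rewrite -xy.
apply: (@differentiable_squeeze _ _ Psi u_infty (cone y b)).
- exact: Psi_diff.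
- exact: differentiable_cone.
- by rewrite ux0.
- by rewrite Kx0 u_infty_K.
(* The squeeze holds on the whole open set [Omega]: [Psi] bounds every admissible cone from below,
   and [cone y b] is one of them. *)
apply: filterS (open_nbhs_nbhs (conj oO Ox0')) => z Oz.
rewrite u_infty_K; last exact: subset_closure.
apply/andP; split.
  apply: lb_le_inf; first by exists (cone y b z), (y, b).
  by move=> _ [yb [_ _ _ /(_ _ Oz) ?] <-].
apply: ge_inf; last by exists (y, b).
by exists (Psi z) => _ [yb [_ _ _ /(_ _ Oz) ?] <-].
Qed.
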